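(* Let $\mathbb{F}_q$ be a finite field of characteristic different from $2$ and $3$, let $E: y^2=x^3+Ax+B$ with $A,B\in\mathbb{F}_q$ be an elliptic curve, and let $T_3$ be the trace zero subgroup of $E(\mathbb{F}_{q^3})$. For an affine point $P=(X,Y)\in T_3$ put $$\mathrm{compr}(P)=(S_1,S_2)\in\mathbb{F}_q^2,\qquad S_1=X+X^q+X^{q^2},\quad S_2=X^{1+q}+X^{1+q^2}+X^{q+q^2}.$$ Let $P\in T_3$ be an affine point with $\mathrm{compr}(P)=(S_1,S_2)$ and $S_1\ne0$. Then the affine points $Q\in T_3$ with $\mathrm{compr}(Q)=\mathrm{compr}(P)$ are exactly the points $\pm P,\pm\varphi(P),\pm\varphi^2(P)$.
   Context: $\mathcal{O}$ denotes the point at infinity, the neutral element of $E$; affine points are points different from $\mathcal{O}$. The Frobenius endomorphism is $\varphi:E\to E$, $(X,Y)\mapsto(X^q,Y^q)$, $\mathcal{O}\mapsto\mathcal{O}$. The trace map is $\mathrm{Tr}:E(\mathbb{F}_{q^3})\to E(\mathbb{F}_q)$, $P\mapsto P+\varphi(P)+\varphi^2(P)$, and $T_3=\ker(\mathrm{Tr})\subseteq E(\mathbb{F}_{q^3})$. *)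

(* Defs.v *)
From HB Require Import structures.
From mathcomp Require Import all_boot all_order all_algebra all_field.
From mathcomp Require Import ring.

Set Implicit Arguments.
Unset Strict Implicit.
Unset Printing Implicit Defensive.

Import GRing.Theory.
Local Open Scope ring_scope.

(* Discriminant of the short Weierstrass equation y^2 = x^3 + a x + b; when
   the characteristic is not 2 or 3, the equation defines an elliptic curve
   iff it is nonzero. *)
Definition disc (K : fieldType) (a b : K) : K :=
  - (16%:R * (4%:R * a ^+ 3 + 27%:R * b ^+ 2)).

Inductive point (K : Type) : Type :=
  | Infinity
  | Affine of K & K.
Arguments Infinity {K}.

Section CurveOperations.
Variable K : fieldType.
Implicit Types (a b : K) (P Q : point K).

Definition on_curve a b P : bool :=
  if P is Affine x y then y ^+ 2 == x ^+ 3 + a * x + b else true.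

Definition neg P : point K :=
  if P is Affine x y then Affine x (- y) else Infinity.

(* The third intersection point with y^2 = x^3 + a x + b of the line of slope s
   through (x1, y1) and another point of abscissa x2, reflected in the x-axis *)
Definition reflected_third (s x1 y1 x2 : K) : point K :=
  let x3 := s ^+ 2 - x1 - x2 in Affine x3 (s * (x1 - x3) - y1).

(* Chord-and-tangent law. Two points of the curve with the same abscissa are
   equal or opposite, so the tangent case is only reached with equal points
   and y1 != 0. *)
Definition add a P Q : point K :=
  match P, Q with
  | Infinity, _ => Q
  | _, Infinity => P
  | Affine x1 y1, Affine x2 y2 =>
      if x1 != x2 then reflected_third ((y2 - y1) / (x2 - x1)) x1 y1 x2
      else if y1 == - y2 then Infinity
      else reflected_third ((3%:R * x1 ^+ 2 + a) / (2%:R * y1)) x1 y1 x2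
  end.

Definition frob (q : nat) P : point K :=
  if P is Affine x y then Affine (x ^+ q) (y ^+ q) else Infinity.

Definition trace a (q : nat) P : point K :=
  add a (add a P (frob q P)) (frob q (frob q P)).

Lemma add_on_curve a b P Q :
  2%N \notin [pchar K] ->
  on_curve a b P -> on_curve a b Q -> on_curve a b (add a P Q).
Proof.
move=> ch2; case: P => [|x1 y1]; case: Q => [|x2 y2] //= /eqP e1 /eqP e2.
have b1 : b = y1 ^+ 2 - x1 ^+ 3 - a * x1 by rewrite e1; ring.
case: eqP => [ex|/eqP nx] /=; last first.
  have d0 : x2 - x1 != 0 by rewrite subr_eq0 eq_sym.
  have ea : a = (y2 ^+ 2 - y1 ^+ 2 - x2 ^+ 3 + x1 ^+ 3) / (x2 - x1).
    by apply: (canRL (mulfK d0)); rewrite e1 e2; ring.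
  by apply/eqP; rewrite b1 ea; field.
case: eqP => // /eqP ny.
have /eqP: y1 ^+ 2 - y2 ^+ 2 = 0 by rewrite e1 e2 ex; ring.
rewrite subr_sqr mulf_eq0 subr_eq0 addr_eq0 (negPf ny) orbF => /eqP ey.
have two0 : (2%:R : K) != 0.
  by apply: contra ch2 => ?; rewrite inE /=.
have y0 : y1 != 0.
  by apply: contra ny => /eqP z; rewrite -ey z oppr0.
rewrite /= -ex; apply/eqP; rewrite b1; field.
by rewrite y0 two0.
Qed.

End CurveOperations.

Section TraceZero.
Variables (F : finFieldType) (L : fieldExtType F).
Local Notation q := #|F|.

Definition trace_zero (A B : F) (P : point L) : Prop :=
  on_curve A%:A B%:A P /\ trace A%:A q P = Infinity.

(* compr of an affine point, as a function of its abscissa. The values are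
   taken in L; they lie in F by compr_in_base. *)
Definition compr (X : L) : L * L :=
  (X + X ^+ q + X ^+ (q ^ 2)%N,
   X ^+ (1 + q)%N + X ^+ (1 + q ^ 2)%N + X ^+ (q + q ^ 2)%N).

Lemma frobD (x y : L) : (x + y) ^+ q = x ^+ q + y ^+ q.
Proof.
have [p p_pr chFp] := finPcharP F.
have chLp : p \in [pchar L] by rewrite pchar_lalg.
apply: exprDn_pchar; have [n ->] : exists n, q = (p ^ n)%N.
  by exists (logn p q); exact: (@card_pprimeChar p F chFp).
by rewrite pnatX pnatE // chLp.
Qed.

Lemma compr_in_base (X : L) : \dim {:L} = 3%N ->
  exists S1 S2 : F, compr X = (S1%:A, S2%:A).
Proof.
move=> d3.
have X3 : X ^+ (q ^ 3)%N = X.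
  have := memvf X; rewrite (Fermat's_little_theorem {:L}%AS X) d3.
  by move/eqP.
have base (z : L) : z ^+ q = z -> exists S : F, z = S%:A.
  move=> zq; apply/vlineP.
  by rewrite (Fermat's_little_theorem 1%AS z) dimv1 expn1 zq.
have qq : (q ^ 2 * q)%N = (q ^ 3)%N by rewrite -expnSr.
have [|S1 e1] := base (compr X).1.
  by rewrite /= !frobD -!exprM qq X3 mulnn addrC addrA.
have [|S2 e2] := base (compr X).2.
  rewrite /= !frobD -!exprM !mulnDl mul1n qq mulnn !exprD X3 expr1.
  by move: (X ^+ q) (X ^+ (q ^ 2)%N) => u v; ring.
by exists S1, S2; rewrite [LHS]surjective_pairing e1 e2.
Qed.

End TraceZero.

(* Main.v *)
(** Three points of [E] summing to the neutral element lie on a line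
    [y = l x + m], so their abscissas are the roots of
    [x^3 + A x + B - (l x + m)^2]; hence their elementary symmetric functions
    are [l^2], [A - 2 l m] and [m^2 - B].  When the first is nonzero, the first
    two determine the third, since [l^2 m^2 = (l m)^2].  Applied to a point of
    [T_3] and its conjugates, this shows that [compr P] determines the cubic
    with roots [X], [X^q], [X^(q^2)].  Conversely, [compr] is symmetric in the
    conjugates, and the trace commutes with negation and Frobenius because the
    chord-and-tangent formulas do. *)

Require Import Defs.
From HB Require Import structures.
From mathcomp Require Import all_boot all_order all_algebra all_field.
From mathcomp Require Import ring.

Import GRing.Theory.
Local Open Scope ring_scope.

(** * The chord-and-tangent law and collinear points *)

Section CurveLemmas.
Context {K : fieldType}.
Implicit Types (a b : K) (P Q : point K).
Local Notation add := Defs.add.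

Lemma sqr_eq_opp (y y' : K) : y ^+ 2 = y' ^+ 2 -> y = y' \/ y = - y'.
Proof. by move/eqP; rewrite eqf_sqr => /orP[] /eqP; [left | right]. Qed.

Lemma on_curve_neg a b P : on_curve a b (neg P) = on_curve a b P.
Proof. by case: P => //= x y; rewrite sqrrN. Qed.

Lemma on_curve_same_abscissa {a b} {x y y' : K} :
  on_curve a b (Affine x y) -> on_curve a b (Affine x y') ->
  Affine x y = Affine x y' \/ Affine x y = neg (Affine x y').
Proof.
move=> /= /eqP e /eqP e'.
have [->|->] : y = y' \/ y = - y' by apply: sqr_eq_opp; rewrite e e'.
  by left.
by right.
Qed.

Lemma add_neg a P Q : add a (neg P) (neg Q) = neg (add a P Q).
Proof.
case: P Q => [|x1 y1] [|x2 y2] //=.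
case: ifP => _; last (rewrite eqr_opp; case: ifP => _ //).
  have -> : (- y2 - - y1) / (x2 - x1) = - ((y2 - y1) / (x2 - x1)) by ring.
  by rewrite /= /reflected_third sqrrN; congr Affine; ring.
by rewrite /= /reflected_third mulrN invrN mulrN sqrrN; congr Affine; ring.
Qed.

Definition map_point (f : K -> K) P : point K :=
  if P is Affine x y then Affine (f x) (f y) else Infinity.

Lemma map_point_on_curve (f : {rmorphism K -> K}) a b P :
  f a = a -> f b = b -> on_curve a b (map_point f P) = on_curve a b P.
Proof.
move=> fa fb; case: P => //= x y.
by rewrite -{1}fa -{1}fb -!rmorphXn -rmorphM -!rmorphD fmorph_eq.
Qed.

(** The addition formulas are rational in the coordinates and [a], with integer coefficients; since
    a field morphism is injective, the case tests also have the same outcome on both sides. *)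
Lemma map_point_add (f : {rmorphism K -> K}) a P Q :
  f a = a -> add a (map_point f P) (map_point f Q) = map_point f (add a P Q).
Proof.
move=> fa; case: P Q => [|x1 y1] [|x2 y2] //=.
rewrite -[- f y2]rmorphN !fmorph_eq.
have fthird s x y x' :
    reflected_third (f s) (f x) (f y) (f x') =
    map_point f (reflected_third s x y x').
  by rewrite /= !(rmorphXn, rmorphB, rmorphM).
case: ifP => _.
  by rewrite -fthird fmorph_div !rmorphB.
case: ifP => // _.
by rewrite -fthird fmorph_div !(rmorphXn, rmorphD, rmorphM, rmorph_nat) fa.
Qed.

Lemma sum0_collinear {a b x1 y1 x2 y2 x3 y3} :
  2%N \notin [pchar K] ->
  on_curve a b (Affine x1 y1) -> on_curve a b (Affine x2 y2) ->
  add a (add a (Affine x1 y1) (Affine x2 y2)) (Affine x3 y3) = Infinity ->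
  exists l m : K,
    [/\ x1 + x2 + x3 = l ^+ 2,
        x1 * x2 + x1 * x3 + x2 * x3 = a - 2%:R * (l * m)
      & x1 * x2 * x3 = m ^+ 2 - b].
Proof.
move=> ch2 /= /eqP e1 /eqP e2 sum0.
have two0 : (2%:R : K) != 0 by apply: contra ch2 => ?; rewrite inE /=.
have b1 : b = y1 ^+ 2 - x1 ^+ 3 - a * x1 by rewrite e1; ring.
(* For a chord of slope [l], subtracting the curve equations and dividing by [x2 - x1] gives [l *
   (y1 + y2) = x1 ^+ 2 + x1 * x2 + x2 ^+ 2 + a]. With [y2 = y1 + l * (x2 - x1)] this becomes a
   formula for [a] that also covers the tangent. *)
suff [l [el ea]] : exists l : K, x3 = l ^+ 2 - x1 - x2 /\
    a = l * (2%:R * y1 + l * (x2 - x1)) - (x1 ^+ 2 + x1 * x2 + x2 ^+ 2).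
  by exists l, (y1 - l * x1); rewrite b1 el ea; split; ring.
have third s : add a (reflected_third s x1 y1 x2) (Affine x3 y3) = Infinity ->
    x3 = s ^+ 2 - x1 - x2.
  by rewrite /=; case: eqP => //= ->.
move: sum0; case: (eqVneq x1 x2) => [ex|nx] /=; last first.
  have d0 : x2 - x1 != 0 by rewrite subr_eq0 eq_sym.
  move/third => e3; exists ((y2 - y1) / (x2 - x1)); split=> //.
  have -> : a = (y2 ^+ 2 - y1 ^+ 2 - x2 ^+ 3 + x1 ^+ 3) / (x2 - x1).
    by apply: (canRL (mulfK d0)); rewrite e1 e2; ring.
  by field.
(* If [y1 = - y2], the first two points cancel and the sum is the affine third point, a
   contradiction. *)
case: eqP => [//|/eqP ny] /third e3.
have [ey|ey] : y1 = y2 \/ y1 = - y2 by apply: sqr_eq_opp; rewrite e1 e2 ex.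
  have y0 : y1 != 0.
    by apply: contra ny => /eqP z; rewrite -ey z oppr0.
  exists ((3%:R * x1 ^+ 2 + a) / (2%:R * y1)); split=> //.
  by rewrite -ex; field; rewrite y0 two0.
by rewrite ey eqxx in ny.
Qed.

(** The slope is known only up to sign, but fixing [l * m] forces [m] to change sign with it, so
    [m ^+ 2] is unaffected. *)
Lemma third_symmetric_determined {a b l m l' m' : K} :
  2%N \notin [pchar K] -> l ^+ 2 != 0 ->
  l' ^+ 2 = l ^+ 2 -> a - 2%:R * (l' * m') = a - 2%:R * (l * m) ->
  m' ^+ 2 - b = m ^+ 2 - b.
Proof.
move=> ch2 l0 el /addrI/oppr_inj em.
have two0 : (2%:R : K) != 0 by apply: contra ch2 => ?; rewrite inE /=.
congr (_ - _); apply: (mulfI l0).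
by rewrite -{1}el -!exprMn (mulfI two0 em).
Qed.

Lemma same_symmetric_root {z z1 z2 x x1 x2 : K} :
  z + z1 + z2 = x + x1 + x2 ->
  z * z1 + z * z2 + z1 * z2 = x * x1 + x * x2 + x1 * x2 ->
  z * z1 * z2 = x * x1 * x2 ->
  [\/ z = x, z = x1 | z = x2].
Proof.
move=> e1 e2 e3.
have : (z - x) * (z - x1) * (z - x2) = 0.
  (* By Vieta, this is also the monic cubic with roots [z], [z1], [z2], evaluated at [z]. *)
  transitivity (z ^+ 3 - (x + x1 + x2) * z ^+ 2
    + (x * x1 + x * x2 + x1 * x2) * z - x * x1 * x2); first by ring.
  by rewrite -e1 -e2 -e3; ring.
move/eqP; rewrite !mulf_eq0 !subr_eq0 -orbA.
by case/or3P => /eqP; [constructor 1 | constructor 2 | constructor 3].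
Qed.

End CurveLemmas.

(** * Frobenius and the trace zero subgroup *)

Section Frobenius.
Variables (F : finFieldType) (L : fieldExtType F).
Local Notation add := Defs.add.

(** Named so that it can carry a ring morphism structure, which makes the lemmas on [map_point]
    applicable to [frob]. *)
Definition frobenius (x : L) : L := x ^+ #|F|.

Lemma frobenius_is_zmod_morphism : zmod_morphism frobenius.
Proof.
move=> x y; apply: (addIr (frobenius y)).
by rewrite subrK /frobenius -frobD subrK.
Qed.

Lemma frobenius_is_monoid_morphism : monoid_morphism frobenius.
Proof. by split=> [|x y]; rewrite /frobenius ?expr1n ?exprMn. Qed.

HB.instance Definition _ :=
  GRing.isZmodMorphism.Build L L frobenius frobenius_is_zmod_morphism.
HB.instance Definition _ :=
  GRing.isMonoidMorphism.Build L L frobenius frobenius_is_monoid_morphism.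

Lemma frobenius_base (c : F) : frobenius c%:A = c%:A.
Proof. by rewrite /frobenius exprZn expr1n expf_card. Qed.

Lemma frobenius3 (x : L) :
  \dim {:L} = 3%N -> frobenius (frobenius (frobenius x)) = x.
Proof.
move=> d3; have := memvf x.
rewrite (Fermat's_little_theorem {:L}%AS x) d3 => /eqP.
by rewrite !expnS expn0 muln1 !exprM.
Qed.

Lemma comprE (x : L) (x1 := frobenius x) (x2 := frobenius x1) :
  compr x = (x + x1 + x2, x * x1 + x * x2 + x1 * x2).
Proof. by rewrite /compr !exprD expr1 -mulnn exprM. Qed.

(** Frobenius permutes the three conjugates cyclically, its cube being the identity on [L]. *)
Lemma compr_frobenius (x : L) :
  \dim {:L} = 3%N -> compr (frobenius x) = compr x.
Proof. by move=> d3; rewrite !comprE frobenius3 //; congr pair; ring. Qed.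

Lemma trace_zero_neg {A B : F} {P : point L} :
  trace_zero A B P -> trace_zero A B (neg P).
Proof.
have frob_neg (Q : point L) : frob #|F| (neg Q) = neg (frob #|F| Q).
  by case: Q => //= x y; congr Affine; exact: (rmorphN frobenius).
case=> cP tP; split; first by rewrite on_curve_neg.
by rewrite /trace !frob_neg !add_neg -/(trace _ _ _) tP.
Qed.

Lemma on_curve_frob (A B : F) (P : point L) :
  on_curve A%:A B%:A (frob #|F| P) = on_curve A%:A B%:A P.
Proof. by apply: (map_point_on_curve frobenius); exact: frobenius_base. Qed.

Lemma trace_zero_frob {A B : F} {P : point L} :
  trace_zero A B P -> trace_zero A B (frob #|F| P).
Proof.
have frob_add (Q R : point L) :
    add A%:A (frob #|F| Q) (frob #|F| R) = frob #|F| (add A%:A Q R).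
  by apply: (map_point_add frobenius); exact: frobenius_base.
case=> cP tP; split; first by rewrite on_curve_frob.
by rewrite /trace !frob_add -/(trace _ _ _) tP.
Qed.

(** Trace zero means that a point and its conjugates sum to the neutral element, hence are
    collinear; [(compr x).1] is then the squared slope of their line. *)
Lemma compr_determines_norm {A B : F} {x y x' y' : L} :
  2%N \notin [pchar F] ->
  trace_zero A B (Affine x y) -> trace_zero A B (Affine x' y') ->
  (compr x).1 != 0 -> compr x' = compr x ->
  x' * frobenius x' * frobenius (frobenius x') =
  x * frobenius x * frobenius (frobenius x).
Proof.
rewrite -(pchar_lalg L) !comprE => ch2 [cP tP] [cQ tQ] S1 [e1 e2].
have cP1 := cP; rewrite -on_curve_frob in cP1.
have cQ1 := cQ; rewrite -on_curve_frob in cQ1.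
have [l [m [P1 P2 P3]]] := sum0_collinear ch2 cP cP1 tP.
have [l' [m' [Q1 Q2 Q3]]] := sum0_collinear ch2 cQ cQ1 tQ.
rewrite [LHS]Q3 [RHS]P3; apply: (third_symmetric_determined (a := A%:A) (l := l) (l' := l') ch2).
- by rewrite -P1.
- by rewrite -P1 -Q1.
- by rewrite -P2 -Q2.
Qed.

End Frobenius.

Theorem mainTheorem4 (F : finFieldType) (L : fieldExtType F) (A B : F)
    (X Y : L) (P := Affine X Y) (q := #|F|) :
  2%N \notin [pchar F] -> 3%N \notin [pchar F] ->
  disc A B != 0 ->
  \dim {:L} = 3%N ->
  trace_zero A B P ->
  (compr X).1 != 0 ->
  forall (X' Y' : L) (Q := Affine X' Y'),
    trace_zero A B Q /\ compr X' = compr X <->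
    Q = P \/ Q = neg P \/
    Q = frob q P \/ Q = neg (frob q P) \/
    Q = frob q (frob q P) \/ Q = neg (frob q (frob q P)).
Proof.
move=> ch2 _ _ d3 tP S1 X' Y' Q; split=> [[tQ eC]|].
  have e3 := compr_determines_norm _ _ ch2 tP tQ S1 eC.
  have [cP cQ] := (proj1 tP, proj1 tQ).
  have cP1 := cP; rewrite -on_curve_frob in cP1.
  have cP2 := cP1; rewrite -on_curve_frob in cP2.
  move: eC; rewrite !comprE => -[e1 e2].
  (* [X'] is a conjugate of [X], and the abscissa fixes a point of the curve up to sign. *)
  case: (same_symmetric_root e1 e2 e3) => eX; move: cQ; rewrite /Q eX => cQ.
  - by have := on_curve_same_abscissa cQ cP; tauto.
  - by have := on_curve_same_abscissa cQ cP1; tauto.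
  - by have := on_curve_same_abscissa cQ cP2; tauto.
have tP1 := trace_zero_frob _ _ tP.
have tP2 := trace_zero_frob _ _ tP1.
have c1 : compr (X ^+ q) = compr X by exact: compr_frobenius.
have c2 : compr ((X ^+ q) ^+ q) = compr X.
  by rewrite -c1; exact: compr_frobenius.
(* The equation for [Q] is used twice: as a whole for the trace condition, and through its first
   coordinate for [compr X']. *)
by case=> [|[|[|[|[|]]]]] eQ; rewrite eQ; case: eQ => -> _;
  split=> //; apply: trace_zero_neg.
Qed.
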